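(* For any graph $G=(V,E)$, let $|V|=n$, $|E|=m$ and $$\Delta = 4n(n-1)-\frac{16m}{k-1}+1,$$ where $\Delta=\Theta(n^2)$ for $k\geq 4$, and $\Delta=\Theta\left(\binom{n}{2}-m\right)$ for $k=3$. Then $$a_k(G)\geq \frac{1}{2}\left(2n+1-\sqrt{\Delta}\right)$$ for any $k\geq 3$.
   Context: Graphs are finite, simple and undirected, and $k$ is an integer. Let $\mathcal{C}_k=\{C_i : i\geq k\}$ be the family of all cycles of length at least $k$. A $C_k$-coloring of a graph $G$ is a proper vertex coloring of $G$ in which no subgraph of $G$ that is a member of $\mathcal{C}_k$ is bicolored, i.e. has its vertices colored using only two colors. The $C_k$-chromatic number $a_k(G)$ is the minimum number of colors needed for a $C_k$-coloring of $G$. Here $\Delta$ is just the number defined in the claim, not the maximum degree; $\binom{n}{2}-m$ is the number of nonedges of $G$; and $\Theta$ is the usual asymptotic notation for ''is of the order of''. *)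

(* Defs.v *)
From mathcomp Require Import all_boot all_order all_algebra.
From mathcomp Require Import boolp reals.
Set Implicit Arguments.
Unset Strict Implicit.
Unset Printing Implicit Defensive.
Import Order.TTheory GRing.Theory Num.Theory.
Local Open Scope ring_scope.

Record sgraph := SGraph {
  vertex :> finType;
  adj : rel vertex;
  adj_sym : symmetric adj;
  adj_irr : irreflexive adj
}.

Definition edges (G : sgraph) : {set {set G}} :=
  [set A : {set G} | [exists x : G, [exists y : G, adj x y && (A == [set x; y])]]].

(* [p] lists the vertices of a subgraph C_(size p) of [G] in cyclic order. *)
Definition is_cycle (G : sgraph) (p : seq G) : bool :=
  [&& (3 <= size p)%N, uniq p & cycle (@adj G) p].

Definition proper_coloring (G : sgraph) (c : nat) (f : G -> 'I_c) : Prop :=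
  forall x y : G, adj x y -> f x != f y.

Definition bicolored (G : sgraph) (c : nat) (f : G -> 'I_c) (p : seq G) : bool :=
  #|[set f x | x in p]| == 2%N.

Definition Ck_coloring (k : nat) (G : sgraph) (c : nat) (f : G -> 'I_c) : Prop :=
  proper_coloring f /\
  forall p : seq G, is_cycle p -> (k <= size p)%N -> ~~ bicolored f p.

Definition Ck_colorable (k : nat) (G : sgraph) (c : nat) : bool :=
  `[< exists f : G -> 'I_c, Ck_coloring k f >].

Lemma Ck_colorable_ex (k : nat) (G : sgraph) : exists c, Ck_colorable k G c.
Proof.
exists #|G|; apply/asboolP; exists (@enum_rank G); split=> [x y xy|p].
  apply/eqP => /enum_rank_inj exy.
  by move: xy; rewrite exy adj_irr.
case/and3P => p3 up _ _; rewrite /bicolored card_imset; last exact: enum_rank_inj.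
by rewrite (card_uniqP up) neq_ltn p3 orbT.
Qed.

Definition Ck_chromatic (k : nat) (G : sgraph) : nat :=
  ex_minn (Ck_colorable_ex k G).

Definition Delta (R : realType) (k : nat) (G : sgraph) : R :=
  4 * #|G|%:R * (#|G|%:R - 1) - 16 * #|edges G|%:R / (k%:R - 1) + 1.

Definition nonedges (R : realType) (G : sgraph) : R :=
  'C(#|G|, 2)%:R - #|edges G|%:R.

(* Main.v *)
Require Import Defs.
From mathcomp Require Import all_boot all_order all_algebra.
From mathcomp Require Import boolp reals.
From mathcomp Require Import zify ring lra.
Import Order.TTheory GRing.Theory Num.Theory.
Local Open Scope ring_scope.

(** A bipartite graph without cycles of length at least [2t+2] has a vertex of
    degree at most [t]: all neighbours of the first vertex of a longest path lie
    at odd positions on that path, so [t+1] of them would close a cycle of length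
    at least [2t+2]. Deleting such vertices one at a time bounds the number of
    edges on [N > 0] vertices by [t(N-1)]. In a [C_k]-coloring this applies, with
    [t = (k-1)/2] rounded down, to any two of the [a] nonempty color classes;
    summing over the pairs gives [4m/(k-1) <= (a-1)(2n-a)], a quadratic inequality
    in [a] whose discriminant is [Delta]. *)

(** * Longest paths and long cycles in bipartite graphs *)

Lemma longest_path (T : finType) (e : rel T) (A : {set T}) :
  A != set0 ->
  exists x s, [/\ uniq (x :: s), path e x s, {subset x :: s <= A} &
    forall y, y \in A -> e y x -> y \in x :: s].
Proof.
case/set0Pn => x0 x0A.
pose P n := `[< exists x s, [/\ uniq (x :: s), path e x s,
  {subset x :: s <= A} & size s = n] >].
have exP : exists n, P n.
  exists 0%N; apply/asboolP; exists x0, [::]; split=> //.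
  by move=> y; rewrite inE => /eqP ->.
have ubP n : P n -> (n <= #|T|)%N.
  move=> /asboolP[x [s [us _ _ <-]]].
  by apply: (@leq_trans (size (x :: s))) => //; rewrite -(card_uniqP us) max_card.
case: (ex_maxnP exP ubP) => n /asboolP[x [s [us ps sA sn]]] maxn.
exists x, s; split=> // y yA eyx; apply/negP => /negP yNs.
(* A neighbor [y] off the path could be prepended, giving a longer path inside [A]. *)
have /maxn : P n.+1; last by rewrite ltnn.
apply/asboolP; exists y, (x :: s); split=> //=.
- by rewrite yNs.
- by rewrite eyx.
- by move=> z; rewrite inE => /predU1P[->//|/sA].
- by rewrite sn.
Qed.

(** Sides alternate along the path. Since [s] omits the starting vertex, its entry [i] is [i + 1]
    steps away from [x], whence [~~ odd i]. *)
Lemma path_bipartite_nth {T : eqType} {e : rel T} {b : T -> bool} {x s} :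
  (forall y z, y \in x :: s -> z \in x :: s -> e y z -> b y != b z) ->
  path e x s -> forall i, (i < size s)%N -> b (nth x s i) = b x (+) ~~ odd i.
Proof.
move=> bip /(pathP x) ps; elim=> [|i IHi] lti.
  have := bip _ _ _ _ (ps 0%N lti); rewrite /= mem_head inE mem_nth ?orbT //.
  by move/(_ isT isT); case: (b x); case: (b _).
have := bip _ _ _ _ (ps i.+1 lti); rewrite /= !inE !mem_nth ?orbT //; last exact: ltnW.
move/(_ isT isT); rewrite IHi; last exact: ltnW.
by case: (b x); case: (b _); case: (odd i).
Qed.

Lemma bipartite_long_cycle (G : sgraph) (b : G -> bool) (A : {set G}) t :
  (0 < t)%N -> A != set0 ->
  (forall x y, x \in A -> y \in A -> adj x y -> b x != b y) ->
  (forall x, x \in A -> t < #|[set y in A | adj x y]|)%N ->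
  exists p : seq G, [/\ is_cycle p, {subset p <= A} & (t.*2.+2 <= size p)%N].
Proof.
move=> t0 A0 bip deg.
have [x [s [us ps sA maxs]]] := longest_path _ (@adj G) _ A0.
have xA : x \in A by apply: sA; rewrite mem_head.
have nbr y : y \in [set y in A | adj x y] -> y \in s.
  rewrite inE => /andP[yA xy].
  have := maxs y yA; rewrite adj_sym => /(_ xy); rewrite inE => /predU1P[yx|//].
  by rewrite yx adj_irr in xy.
have even_index y : y \in [set y in A | adj x y] -> ~~ odd (index y s).
  move=> yN; have ys := nbr _ yN; move: yN; rewrite inE => /andP[yA xy].
  have bip' y' z' : y' \in x :: s -> z' \in x :: s -> adj y' z' -> b y' != b z'.
    by move=> /sA ? /sA; apply: bip.
  have := path_bipartite_nth bip' ps (index y s); rewrite index_mem nth_index //.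
  move/(_ ys); have := bip _ _ xA yA xy.
  by case: (b x); case: (b y); case: odd.
(* Pigeonhole: the more than [t] neighbors of [x] have distinct even indices in [s]. Were all of
   these below [2t], halving them would inject the neighbors into [t] numbers. *)
have [y yN ley] : exists2 y, y \in [set y in A | adj x y] & (t.*2 <= index y s)%N.
  apply/exists_inP; apply: contraT => /exists_inPn small.
  have := deg _ xA; rewrite ltnNge => /negP[].
  rewrite cardE -(size_map (fun y => (index y s)./2)) -(size_iota 0 t).
  apply: uniq_leq_size; last first.
    move=> z /mapP[y]; rewrite mem_enum => /small + ->; rewrite mem_iota /=; lia.
  rewrite map_inj_in_uniq ?enum_uniq // => y z; rewrite !mem_enum => yN zN yz.
  rewrite -(nth_index x (nbr _ yN)) -(nth_index x (nbr _ zN)); congr nth.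
  have := even_index _ yN; have := even_index _ zN; lia.
have ys := nbr _ yN; have := yN; rewrite inE => /andP[yA xy].
(* The path from [x] up to [y], closed by the edge from [y] to [x], has [index y s + 2] vertices. *)
exists (x :: take (index y s).+1 s).
have sz : size (take (index y s).+1 s) = (index y s).+1.
  by rewrite size_takel // index_mem.
split; last by rewrite /= sz; lia.
- rewrite /is_cycle; apply/and3P; split.
  + by rewrite /= sz; lia.
  + by apply: (@subseq_uniq _ _ (x :: s)) us; rewrite /= eqxx take_subseq.
  + rewrite /= rcons_path take_path //=.
    by rewrite -nth_last sz /= nth_take // nth_index // adj_sym.
- by move=> z zp; apply: sA; move: zp; rewrite !inE => /predU1P[->|/mem_take ->];
    rewrite ?eqxx ?orbT.
Qed.

(** * Edge counts by vertex deletion *)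

Definition edges_in (G : sgraph) (A : {set G}) : {set {set G}} :=
  [set E in edges G | E \subset A].

(** The edges lost with [x] all lie in the image of its neighborhood under [y] mapped to
    [[set x; y]]. *)
Lemma edges_in_delete (G : sgraph) (A : {set G}) x :
  (#|edges_in G A| <=
     #|edges_in G (A :\ x)| + #|[set y in A | adj x y]|)%N.
Proof.
apply: leq_trans (leq_add (leqnn _) (leq_imset_card (fun y => [set x; y]) _)).
apply: leq_trans (leq_card_setU _ _).
apply/subset_leq_card/subsetP => E; rewrite !inE => /andP[EG EA].
rewrite EG subsetD1 EA /=.
case: (boolP (x \in E)) => //= xE; apply/imsetP.
case/existsP: EG => u /existsP[v /andP[uv /eqP defE]].
move: xE EA; rewrite defE !inE subUset !sub1set => xE /andP[uA vA].
case/orP: xE => /eqP ->.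
- by exists v; rewrite // inE vA.
- by exists u; rewrite 1?setUC // inE uA adj_sym.
Qed.

(** Adding [t] on the left expresses the bound [t(N-1)] without truncated subtraction. The induction
    is on an upper bound for [#|A|], removing a vertex of degree at most [t] each time. *)
Lemma bipartite_edge_bound (G : sgraph) (b : G -> bool) t (A : {set G}) :
  (0 < t)%N -> A != set0 ->
  (forall x y, x \in A -> y \in A -> adj x y -> b x != b y) ->
  (forall p : seq G, is_cycle p -> {subset p <= A} -> (size p < t.*2.+2)%N) ->
  (#|edges_in G A| + t <= t * #|A|)%N.
Proof.
move=> t0; move: {2}#|A| (leqnn #|A|) => n; elim: n A => [|n IHn] A leA A0 bip nocyc.
  by move: A0; rewrite -card_gt0; lia.
have [x xA degx] : exists2 x, x \in A & (#|[set y in A | adj x y]| <= t)%N.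
  apply/exists_inP; apply: contraT => /exists_inPn deg.
  have [x xA|p [cp pA szp]] := @bipartite_long_cycle G b A t t0 A0 bip.
    by rewrite ltnNge deg.
  by have := nocyc p cp pA; rewrite ltnNge szp.
have := edges_in_delete _ A x; rewrite [#|A|](cardsD1 x) xA => ledel.
(* The induction hypothesis needs a nonempty set, so a single remaining vertex, which spans no edge,
   is treated apart. *)
have [Ax0|Ax0] := eqVneq (A :\ x) set0.
  have -> : edges_in G A = set0.
    apply/setP => E; rewrite !inE; apply/negP => /andP[/existsP[u /existsP[v]]].
    case/andP=> uv /eqP-> ; rewrite subUset !sub1set => /andP[uA vA].
    have eqx w : w \in A -> w = x.
      by move=> wA; apply/eqP; move/setP/(_ w): Ax0; rewrite !inE wA andbT => /negbFE.
    by move: uv; rewrite (eqx u) // (eqx v) // adj_irr.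
  rewrite cards0; lia.
have sub : A :\ x \subset A by apply: subsetDl.
have := IHn (A :\ x); rewrite Ax0 => IH.
have {}IH : (#|edges_in G (A :\ x)| + t <= t * #|A :\ x|)%N.
  apply: IH => //.
  - by move: leA; rewrite (cardsD1 x) xA.
  - by move=> u v /(subsetP sub) uA /(subsetP sub); apply: bip.
  - by move=> p cp pA; apply: nocyc => // z /pA /(subsetP sub).
nia.
Qed.

Lemma card_edges (G : sgraph) : (#|edges G| <= 'C(#|G|, 2))%N.
Proof.
rewrite -(card_draws G 2); apply/subset_leq_card/subsetP => E.
rewrite !inE => /existsP[x /existsP[y /andP[xy /eqP->]]].
by rewrite cards2; case: (eqVneq x y) xy => // ->; rewrite adj_irr.
Qed.

(** * Pairs of color classes and the sum over all pairs *)

Lemma color_pair_edge_bound {k : nat} {G : sgraph} {c : nat} {f : G -> 'I_c} {i j} :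
  (3 <= k)%N -> Ck_coloring k f -> i \in codom f -> i != j ->
  (#|edges_in G (f @^-1: [set i; j])| + k.-1./2 <=
     k.-1./2 * (#|f @^-1: [set i]| + #|f @^-1: [set j]|))%N.
Proof.
move=> k3 [prop nobic] iI ij; have ji : j != i by rewrite eq_sym.
have bip x y : x \in f @^-1: [set i; j] -> y \in f @^-1: [set i; j] ->
    adj x y -> (f x == i) != (f y == i).
  move=> xA yA /prop; move: xA yA; rewrite !inE.
  by do 2![case/orP => /eqP ->]; rewrite ?eqxx // (negPf ji).
have -> : (#|f @^-1: [set i]| + #|f @^-1: [set j]| = #|f @^-1: [set i; j]|)%N.
  rewrite preimsetU cardsU [X in (_ - X)%N](_ : _ = 0%N) ?subn0 //.
  apply/eqP; rewrite cards_eq0; apply/eqP/setP => x; rewrite !inE.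
  by case: eqP => // ->; rewrite (negPf ij).
apply: (@bipartite_edge_bound G (fun x => f x == i)) => //; first by lia.
  by case/codomP: iI => x ->; apply/set0Pn; exists x; rewrite !inE eqxx.
move=> p cp pA; rewrite ltnNge; apply/negP => szp.
(* With [t = k.-1./2], [2t + 2] is [k] or [k + 1] according to the parity of [k], so the cycle is
   long enough to be forbidden. *)
have /negP := nobic p cp ltac:(lia); apply.
case/and3P: cp; case: p pA {szp} => [|x [|y p]] // pA _ _ /= /andP[xy _].
have xp : x \in [:: x, y & p] by rewrite mem_head.
have yp : y \in [:: x, y & p] by rewrite !inE eqxx orbT.
(* Writing 2 as [(f x != f y).+1] lets [cards2] identify it with the size of [[set f x; f y]], which
   is then shown to be the set of colors on the cycle. *)
rewrite /bicolored -[2%N]/(true.+1) -(prop _ _ xy) -cards2; apply/eqP; congr #|pred_of_set _|.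
apply/eqP; rewrite eqEsubset; apply/andP; split; last first.
  by rewrite subUset !sub1set !imset_f.
apply/subsetP => _ /imsetP[z /pA zA ->].
have := prop _ _ xy; move: zA (pA x xp) (pA y yp); rewrite !inE.
by do 3![case/orP => /eqP ->]; rewrite ?eqxx ?orbT.
Qed.

Lemma sum_pairs_sym (c : nat) (I : {set 'I_c}) (F : 'I_c -> 'I_c -> nat) :
  (forall i j, F i j = F j i) ->
  (\sum_(i in I) \sum_(j in I | j != i) F i j =
     2 * \sum_(i in I) \sum_(j in I | i < j) F i j)%N.
Proof.
move=> symF; rewrite mul2n -addnn.
rewrite [X in _ = (_ + X)%N](exchange_big_dep (mem I)) /=; last by move=> ? ? ? /andP[].
rewrite -big_split /=; apply: eq_bigr => i iI.
rewrite (bigID (fun j : 'I_c => i < j)%N) /=; congr (_ + _)%N.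
  by apply: eq_bigl => j; rewrite -val_eqE /=; case: (j \in I) => //=; lia.
under [RHS]eq_bigr do rewrite symF.
by apply: eq_bigl => j; rewrite iI -val_eqE /=; case: (j \in I) => //=; lia.
Qed.

(** Here [a] counts the colors actually used. Over ordered pairs of distinct used colors, every edge
    is counted at least twice, the summand [t] occurs [a(a-1)] times, and the size of each class
    occurs [2(a-1)] times. *)
Lemma Ck_coloring_edge_bound {k : nat} {G : sgraph} {c : nat} {f : G -> 'I_c} {a} :
  (3 <= k)%N -> Ck_coloring k f ->
  a = #|f @: [set: G]| ->
  (2 * #|edges G| + k.-1./2 * (a * a.-1) <= k.-1./2 * (2 * (a.-1 * #|G|)))%N.
Proof.
move=> k3 colf def_a; set t := k.-1./2; set I := f @: [set: G].
pose E i j := #|edges_in G (f @^-1: [set i; j])|.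
pose N i := #|f @^-1: [set i]|.
have cover : (#|edges G| <= \sum_(i in I) \sum_(j in I | (i < j)%N) E i j)%N.
  have card_bigcup (J : finType) (P : pred J) (B : J -> {set {set G}}) :
      (#|\bigcup_(i | P i) B i| <= \sum_(i | P i) #|B i|)%N.
    elim/big_rec2: _ => [|i m S _ le]; first by rewrite cards0.
    by apply: leq_trans (leq_card_setU _ _) _; rewrite leq_add2l.
  apply: leq_trans (leq_sum _ (fun i _ => card_bigcup _ _ _)).
  apply: leq_trans (card_bigcup _ _ _).
  apply/subset_leq_card/subsetP => A AG.
  have AE i j : A \subset f @^-1: [set i; j] -> A \in edges_in G (f @^-1: [set i; j]).
    by move=> sA; rewrite inE AG.
  move: (AG); rewrite inE => /existsP[x /existsP[y /andP[xy /eqP defA]]].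
  have fI z : f z \in I by rewrite imset_f.
  have [ltxy|leyx] := ltnP (f x) (f y).
    apply/bigcupP; exists (f x) => //; apply/bigcupP; exists (f y); rewrite ?fI //.
    by apply: AE; rewrite defA subUset !sub1set !inE !eqxx orbT.
  apply/bigcupP; exists (f y) => //; apply/bigcupP; exists (f x).
    by rewrite fI ltn_neqAle leyx eq_sym val_eqE (colf.1 _ _ xy).
  by apply: AE; rewrite defA subUset !sub1set !inE !eqxx orbT.
have sumN : (\sum_(i in I) N i = #|G|)%N.
  rewrite -cardsT -sum1_card (partition_big_imset f) /=; apply: eq_bigr => i _.
  by rewrite sum1dep_card; apply: eq_card => x; rewrite !inE.
have cardI1 i : i \in I -> #|[pred j in I | j != i]| = a.-1.
  move=> iI; rewrite def_a (cardsD1 i) iI /=; apply: eq_card => j.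
  by rewrite !inE andbC.
have sumE : (\sum_(i in I) \sum_(j in I | j != i) (E i j + t) <=
             \sum_(i in I) \sum_(j in I | j != i) t * (N i + N j))%N.
  apply: leq_sum => i /imsetP[x _ ->]; apply: leq_sum => j /andP[_ ji].
  by apply: color_pair_edge_bound; rewrite ?codom_f // eq_sym.
have sum_const (F : 'I_c -> nat) :
    (\sum_(i in I) \sum_(j in I | j != i) F i = a.-1 * \sum_(i in I) F i)%N.
  by rewrite big_distrr /=; apply: eq_bigr => i iI; rewrite sum_nat_const cardI1.
have sumNr : (\sum_(i in I) \sum_(j in I | j != i) N j = a.-1 * #|G|)%N.
  rewrite -sumN -sum_const (exchange_big_dep (mem I)) /=; last by move=> ? ? ? /andP[].
  by apply: eq_bigr => i iI; apply: eq_bigl => j; rewrite iI eq_sym.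
have splitD (F H : 'I_c -> 'I_c -> nat) :
    (\sum_(i in I) \sum_(j in I | j != i) (F i j + H i j) =
     \sum_(i in I) \sum_(j in I | j != i) F i j +
     \sum_(i in I) \sum_(j in I | j != i) H i j)%N.
  by rewrite -big_split /=; apply: eq_bigr => i _; rewrite big_split.
move: sumE; rewrite splitD sum_pairs_sym; last by move=> i j; rewrite /E setUC.
under [X in (_ <= X)%N]eq_bigr do rewrite -big_distrr.
rewrite -big_distrr /= splitD !sum_const sumNr sumN sum_nat_const -def_a.
have -> : (t * (a * a.-1) = a.-1 * (a * t))%N by ring.
rewrite addnn -mul2n; apply: leq_trans.
by rewrite leq_add2r leq_mul2l cover.
Qed.

(** * From the edge count to the bound with [Delta] *)

Lemma natr_bin2 (R : realType) n : 'C(n, 2)%:R = n%:R * (n%:R - 1) / 2 :> R.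
Proof.
case: n => [|n]; first by rewrite bin0n mul0r mul0r.
have /(congr1 (fun i : nat => i%:R : R)) := bin_ffact n.+1 2.
rewrite ffactnS ffactn1 /= !natrM -[n.+1]addn1 natrD addrK => <-.
by field.
Qed.

Lemma card_edges_le (R : realType) (G : sgraph) :
  #|edges G|%:R <= #|G|%:R * (#|G|%:R - 1) / 2 :> R.
Proof. by rewrite -natr_bin2 ler_nat card_edges. Qed.

Lemma Delta3 (R : realType) (G : sgraph) : Delta R 3 G = 8 * nonedges R G + 1.
Proof. by rewrite /Delta /nonedges natr_bin2; field. Qed.

(** With [a] used colors, [Delta] minus the square equals [4((a-1)(2n-a) - 4m/(k-1))], which the
    edge count makes nonnegative. *)
Lemma Delta_ge_sqr (R : realType) (k : nat) (G : sgraph) (c : nat) (f : G -> 'I_c) :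
  (3 <= k)%N -> Ck_coloring k f ->
  (2 * #|G|%:R + 1 - 2 * #|f @: [set: G]|%:R) ^+ 2 <= Delta R k G.
Proof.
move=> k3 colf; have := Ck_coloring_edge_bound k3 colf erefl.
have := leq_imset_card f [set: G]; rewrite cardsT /Delta.
have : #|f @: [set: G]| = 0%N -> #|G| = 0%N.
  by move/eqP; rewrite cards_eq0 imset_eq0 -cards_eq0 cardsT => /eqP.
(* Without colors the graph is empty and both sides equal 1. Otherwise [a] now stands for one less
   than the number of used colors. *)
have := card_edges G; move: #|edges G| #|f @: [set: G]| #|G| => m [|a] n mn a0 an bound.
  move: mn; rewrite a0 // leqn0 => /eqP ->.
  by rewrite !(mulr0, mul0r, subr0, add0r) expr1n oppr0 add0r.
have k1 : 0 < k%:R - 1 :> R by rewrite subr_gt0 ltr1n; lia.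
suff : 4 * m%:R / (k%:R - 1) <= a%:R * (2 * n%:R - a.+1%:R) :> R.
  rewrite -[a.+1]addn1 natrD; set q := _ / _ => leq_q.
  have -> : 16 * m%:R / (k%:R - 1) = 4 * q by rewrite /q; ring.
  nra.
rewrite ler_pdivrMr // -[2 * n%:R]natrM -natrB; last by lia.
rewrite -[X in _ - X]/(1%:R) -natrB; last by lia.
rewrite -!natrM ler_nat.
have tk : (2 * k.-1./2 <= k - 1)%N by lia.
(* Naming [p = 2n - (a + 1)] additively keeps natural subtraction out of the final product
   estimate. *)
have [p def_p] : exists p, (2 * n = p + a.+1)%N by exists (2 * n - a.+1)%N; lia.
have : (2 * m <= k.-1./2 * (a * p))%N.
  by move: bound; rewrite /= [(2 * (a * n))%N]mulnCA def_p; lia.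
rewrite def_p addnK; nia.
Qed.

(** [Delta] dominates a square, so it is nonnegative and [Num.sqrt] is a genuine root here, at least
    [2n + 1 - 2a] for the number [a <= c] of used colors. *)
Lemma Ck_coloring_lower_bound (R : realType) (k : nat) (G : sgraph) (c : nat)
    (f : G -> 'I_c) :
  (3 <= k)%N -> Ck_coloring k f ->
  1 / 2 * (2 * #|G|%:R + 1 - Num.sqrt (Delta R k G)) <= c%:R.
Proof.
move=> k3 colf.
have leac : #|f @: [set: G]|%:R <= c%:R :> R.
  by rewrite ler_nat -[leqRHS]card_ord max_card.
have := ler_wsqrtr (Delta_ge_sqr R k G c f k3 colf); rewrite sqrtr_sqr.
move/(le_trans (ler_norm _)); lra.
Qed.

Theorem theorem3 (R : realType) :
  [/\ exists c C : R, exists N : nat, [/\ 0 < c, 0 < C &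
        forall (k : nat) (G : sgraph), (4 <= k)%N -> (N <= #|G|)%N ->
          c * #|G|%:R ^+ 2 <= Delta R k G <= C * #|G|%:R ^+ 2],
      exists c C : R, exists N : nat, [/\ 0 < c, 0 < C &
        forall G : sgraph, 0 < nonedges R G -> (N <= #|G|)%N ->
          c * nonedges R G <= Delta R 3 G <= C * nonedges R G]
    & forall (k : nat) (G : sgraph), (3 <= k)%N ->
        1 / 2 * (2 * #|G|%:R + 1 - Num.sqrt (Delta R k G))
          <= (Ck_chromatic k G)%:R].
Proof.
split.
(* As [m <= n(n-1)/2] and [k - 1 >= 3], [Delta] is at least [4n(n-1)/3 + 1], and [n - 1 >= n/2] for
   [n >= 2] gives [2/3]. The upper constant comes from [4n(n-1) + 1 <= 4n^2]. *)
- exists (2 / 3), 4, 2%N; split=> [||k G k4 n2]; [lra | lra | ].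
  have n2R : 2 <= #|G|%:R :> R by rewrite ler_nat.
  have k4R : 4 <= k%:R :> R by rewrite ler_nat.
  have := card_edges_le R G; have : 0 <= #|edges G|%:R :> R by [].
  rewrite /Delta; move: #|edges G|%:R #|G|%:R n2R => m n n2R m0 mn.
  have q0 : 0 <= 16 * m / (k%:R - 1) by apply: divr_ge0; lra.
  have : 16 * m / (k%:R - 1) <= 16 * m / 3.
    by rewrite ler_wpM2l ?lef_pV2 ?posrE; lra.
  move: (16 * m / (k%:R - 1)) q0 => q q0 qm.
  apply/andP; split; nra.
(* [Delta] is [8 * nonedges + 1], and a positive number of nonedges is an integer, hence at least 1
   and able to absorb the added 1. *)
- exists 8, 9, 0%N; split=> [||G ne0 _]; [lra | lra | rewrite Delta3].
  have ne1 : 1 <= nonedges R G.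
    move: ne0; rewrite /nonedges -natrB ?card_edges // ltr0n ler1n //.
  apply/andP; split; lra.
- move=> k G k3; rewrite /Ck_chromatic; case: ex_minnP => c /asboolP[f colf] _.
  exact: Ck_coloring_lower_bound colf.
Qed.
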